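(* Let $n,s$ be two integers such that $s\geq 2$ and $n\geq 2s+2$. Let $\mathcal{F}$ be a $3$-graph with vertex set $[n]$. If $\mathcal{F}$ is $U(s,2s+1)$, then $|\mathcal{F}|\leq \max\{|\mathcal{F}_1|,|\mathcal{F}_2|,|\mathcal{F}_3|\}$.
   Context: $[n]=\{1,\ldots,n\}$, and for a set $X$, $\binom{X}{k}$ is the set of all $k$-element subsets of $X$. A $3$-graph $\mathcal{F}$ with vertex set $[n]$ is identified with its edge set $\mathcal{F}\subseteq\binom{[n]}{3}$, and $|\mathcal{F}|$ is the number of edges. $\mathcal{F}$ is said to be $U(s,q)$ if $|e_1\cup\cdots\cup e_s|\leq q$ for any $s$ edges $e_1,\ldots,e_s$ of $\mathcal{F}$. Given $n$ and $s$, define $\mathcal{F}_1=\{A\in\binom{[n]}{3}: |A\cap[1]|\geq 1\}$, $\mathcal{F}_2=\{A\in\binom{[n]}{3}: |A\cap[s+1]|\geq 2\}$, $\mathcal{F}_3=\{A\in\binom{[n]}{3}: |A\cap[2s+1]|\geq 3\}$. Their sizes are $|\mathcal{F}_1|=\binom{n-1}{2}$, $|\mathcal{F}_2|=\binom{s+1}{2}(n-s-1)+\binom{s+1}{3}$, $|\mathcal{F}_3|=\binom{2s+1}{3}$. *)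

(* Defs.v *)
From mathcomp Require Import all_boot.
Set Implicit Arguments.
Unset Strict Implicit.
Unset Printing Implicit Defensive.

(* The vertex set [n] = {1, ..., n} is 'I_n = {0, ..., n-1}: the ordinal i
   stands for the vertex i + 1, so [k] consists of the ordinals i < k. *)
Definition initial (n k : nat) : {set 'I_n} := [set i : 'I_n | i < k].

Definition triples (n : nat) : {set {set 'I_n}} :=
  [set A : {set 'I_n} | #|A| == 3].

Definition is_3graph (n : nat) (F : {set {set 'I_n}}) : Prop :=
  F \subset triples n.

(* "Any s edges" is read as s distinct edges.  Allowing repetitions gives the
   same property as soon as s <= #|F|, and a stronger one otherwise. *)
Definition is_U (n s q : nat) (F : {set {set 'I_n}}) : Prop :=
  forall e : 'I_s -> {set 'I_n},
    injective e -> (forall i, e i \in F) -> #|\bigcup_(i < s) e i| <= q.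

Definition family1 (n : nat) : {set {set 'I_n}} :=
  [set A in triples n | 1 <= #|A :&: initial n 1|].

Definition family2 (n s : nat) : {set {set 'I_n}} :=
  [set A in triples n | 2 <= #|A :&: initial n s.+1|].

Definition family3 (n s : nat) : {set {set 'I_n}} :=
  [set A in triples n | 3 <= #|A :&: initial n (2 * s).+1|].

(* Main.v *)
Require Import Defs.
From mathcomp Require Import all_boot perm zify.

(** Vertices are 0, ..., n - 1.

    Shifting preserves both the number of edges and the bound on unions of
    at most s edges, so the family may be taken left-compressed.  Such a
    family is a predicate P on sorted triples that is stable under lowering
    entries, and the hypothesis says in particular that no s edges cover
    {0, ..., 2s + 1}; this finite condition is all that the proof keeps
    ([noncovering]).

    If {1, 2, 3} is not an edge, every edge contains 0 and the first family
    wins.  Otherwise the first family can be discarded: the number of edges is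
    at most the larger of |F_2| and |F_3| ([nontrivial_bound]), by induction on
    s.  If {0, 1, 2s + 1} is not an edge, no edge leaves {0, ..., 2s}, which is
    F_3.  If it is one, adding it to s - 1 edges that avoid 0 shows that the
    edges avoiding 0 are again noncovering, for s - 1 on n - 1 vertices.  They
    obey the bound for s - 1 by induction, or all contain 1 and form a small star
    ([tail_star_missing_pair]); only the link of 0 remains to be counted.  The
    link is a compressed graph.  An edge {1, 2, *} together with 0 joined to the
    s - 1 pairs of a nested matching would cover {0, ..., 2s + 1}, so some pair
    of that matching is absent from the link; and a compressed graph that misses
    {j, k} has all its edges inside {0, ..., k - 1} or meeting {0, ..., j - 1}
    ([pair_count_missing_pair]).  The resulting bound is convex in j.  At j = s
    it is exactly |F_2(n, s)| - |F_2(n - 1, s - 1)|, while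
    |F_3(s)| - |F_3(s - 1)| = (2s - 1)^2 leaves enough room elsewhere.  The
    induction starts at s = 2, where edges pairwise intersect. *)

(** * Counting sorted pairs and triples *)

Definition triple_count (n : nat) (P : nat -> nat -> nat -> bool) :=
  \sum_(0 <= c < n) \sum_(0 <= b < c) \sum_(0 <= a < b) (P a b c : nat).

Definition pair_count (n : nat) (Q : nat -> nat -> bool) :=
  \sum_(0 <= c < n) \sum_(0 <= b < c) (Q b c : nat).

(** The edges that avoid the vertex 0, with the other vertices renumbered. *)
Definition tail (P : nat -> nat -> nat -> bool) a b c := P a.+1 b.+1 c.+1.

Lemma triple_count_recl n (P : nat -> nat -> nat -> bool) :
  triple_count n.+1 P = pair_count n (fun b c => P 0 b.+1 c.+1) + triple_count n (tail P).
Proof.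
rewrite /triple_count /pair_count big_nat_recl // big_geq // add0n -big_split.
apply: eq_bigr => c _ /=; rewrite big_nat_recl // big_geq // add0n -big_split.
by apply: eq_bigr => b _ /=; rewrite big_nat_recl.
Qed.

Lemma triple_count_recr n (P : nat -> nat -> nat -> bool) :
  triple_count n.+1 P = triple_count n P + pair_count n (fun a b => P a b n).
Proof. by rewrite /triple_count big_nat_recr. Qed.

Lemma pair_count_recr n (Q : nat -> nat -> bool) :
  pair_count n.+1 Q = pair_count n Q + \sum_(0 <= b < n) (Q b n : nat).
Proof. by rewrite /pair_count big_nat_recr. Qed.

Lemma leq_pair_count n (Q Q' : nat -> nat -> bool) :
  (forall b c, b < c < n -> Q b c -> Q' b c) -> pair_count n Q <= pair_count n Q'.
Proof.
move=> QQ'; rewrite /pair_count !big_mkord; apply: leq_sum => c _.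
rewrite !big_mkord; apply: leq_sum => b _.
by case h: (Q b c) => //; rewrite QQ' // !ltn_ord.
Qed.

Lemma leq_triple_count n (P P' : nat -> nat -> nat -> bool) :
  (forall a b c, a < b < c -> c < n -> P a b c -> P' a b c) ->
  triple_count n P <= triple_count n P'.
Proof.
move=> PP'; rewrite /triple_count !big_mkord; apply: leq_sum => c _.
rewrite !big_mkord; apply: leq_sum => b _.
rewrite !big_mkord; apply: leq_sum => a _.
by case h: (P a b c) => //; rewrite PP' // !ltn_ord.
Qed.

Lemma pair_count_true n : pair_count n (fun _ _ => true) = 'C(n, 2).
Proof.
elim: n => [|n IH]; first by rewrite /pair_count big_geq.
by rewrite pair_count_recr IH sum_nat_const_nat subn0 muln1 binS bin1.
Qed.

Lemma triple_count_true n : triple_count n (fun _ _ _ => true) = 'C(n, 3).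
Proof.
elim: n => [|n IH]; first by rewrite /triple_count big_geq.
by rewrite triple_count_recr IH pair_count_true binS.
Qed.

Lemma pair_count_bin n (Q : nat -> nat -> bool) : pair_count n Q <= 'C(n, 2).
Proof. by rewrite -pair_count_true; apply: leq_pair_count. Qed.

Lemma triple_count_bin n (P : nat -> nat -> nat -> bool) : triple_count n P <= 'C(n, 3).
Proof. by rewrite -triple_count_true; apply: leq_triple_count. Qed.

Lemma pair_count_support m n (Q : nat -> nat -> bool) : m <= n ->
  (forall b c, b < c -> m <= c -> ~~ Q b c) -> pair_count n Q = pair_count m Q.
Proof.
move=> mn Q0; rewrite /pair_count (big_cat_nat (n := m)) //= [X in _ + X]big_nat_cond.
rewrite [X in _ + X]big1 ?addn0 // => c /andP[/andP[mc _] _].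
rewrite big_nat_cond big1 // => b /andP[/andP[_ bc] _].
by rewrite (negbTE (Q0 _ _ _ _)).
Qed.

Lemma triple_count_support m n (P : nat -> nat -> nat -> bool) : m <= n ->
  (forall a b c, a < b < c -> m <= c -> ~~ P a b c) ->
  triple_count n P = triple_count m P.
Proof.
move=> mn P0; rewrite /triple_count (big_cat_nat (n := m)) //= [X in _ + X]big_nat_cond.
rewrite [X in _ + X]big1 ?addn0 // => c /andP[/andP[mc _] _].
rewrite big_nat_cond big1 // => b /andP[/andP[_ bc] _].
rewrite big_nat_cond big1 // => a /andP[/andP[_ ab] _].
by rewrite (negbTE (P0 _ _ _ _ _)) // ab bc.
Qed.

(** * Compressed graphs and 3-graphs *)

Definition left_compressed (P : nat -> nat -> nat -> bool) :=
  forall a b c a' b' c', a' < b' < c' -> a' <= a -> b' <= b -> c' <= c ->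
    P a b c -> P a' b' c'.

Definition left_compressed2 (Q : nat -> nat -> bool) :=
  forall b c b' c', b' < c' -> b' <= b -> c' <= c -> Q b c -> Q b' c'.

Lemma tail_left_compressed P : left_compressed P -> left_compressed (tail P).
Proof. by move=> Pd a b c a' b' c' h ha hb hc; apply: Pd. Qed.

Lemma link_left_compressed P : left_compressed P ->
  left_compressed2 (fun b c => P 0 b.+1 c.+1).
Proof. by move=> Pd b c b' c' h hb hc; apply: Pd. Qed.

Lemma triple_count_star n P : left_compressed P -> ~~ P 1 2 3 ->
  triple_count n.+1 P = pair_count n (fun b c => P 0 b.+1 c.+1).
Proof.
move=> Pd P123; rewrite triple_count_recl (triple_count_support 0) //.
  by rewrite [X in _ + X]/triple_count big_geq // addn0.
by move=> a b c abc _; apply: contraNN P123; apply: Pd; lia.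
Qed.

(** The number of pairs of {0, ..., N - 1} that meet {0, ..., j - 1}, plus the
    number of pairs in a disjoint set of size k. *)
Definition pair_bound (N j k : nat) := 'C(j, 2) + j * (N - j) + 'C(k, 2).

(** Raising {j, k} cannot create an edge, so every edge {b, c} with b < c has
    b < j or c < k. *)
Lemma pair_count_missing_pair N (Q : nat -> nat -> bool) j k :
  left_compressed2 Q -> j <= N -> j < k -> ~~ Q j k ->
  pair_count N Q <= pair_bound N j (k - j).
Proof.
move=> Qdown jN jk Qjk.
(* Row c keeps only the entries below j once c >= k. *)
have row c : \sum_(0 <= b < c) (Q b c : nat) <= minn c j + (if c < k then c - j else 0).
  have [ck|kc] := ltnP c k.
    apply: (@leq_trans (\sum_(0 <= b < c) 1)).
      by apply: leq_sum => b _; apply: leq_b1.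
    rewrite sum_nat_const_nat; lia.
  have [cj|jc] := leqP c j; first by lia.
  rewrite (big_cat_nat (n := j)) //=; last exact: ltnW.
  rewrite [X in _ + X]big_nat_cond [X in _ + X]big1; last first.
    move=> b /andP[/andP[jb bc] _]; case Qbc: (Q b c) => //.
    by case/negP: Qjk; apply: Qdown Qbc.
  rewrite !addn0; apply: (@leq_trans (\sum_(0 <= b < j) 1)).
    by apply: leq_sum => b _; apply: leq_b1.
  by rewrite sum_nat_const_nat; lia.
have bound M : pair_count M Q <= 'C(minn M j, 2) + j * (M - j) + 'C(minn M k - j, 2).
  elim: M => [|M IH]; first by rewrite /pair_count big_geq.
  rewrite pair_count_recr; have := row M; move: IH.
  have [Mj|jM] := boolP (M < j).
    have -> : minn M.+1 j = M.+1 by lia.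
    have -> : minn M.+1 k - j = 0 by lia.
    have -> : minn M j = M by lia.
    have -> : minn M k - j = 0 by lia.
    have -> : M - j = 0 by lia.
    have -> : M.+1 - j = 0 by lia.
    by rewrite binS bin1; move: 'C(M, 2) 'C(0, 2); case: ifP; lia.
  have -> : minn M.+1 j = j by lia.
  have -> : minn M j = j by lia.
  rewrite subSn ?mulnS; last (by lia); case: ifPn => Mk.
    have -> : minn M.+1 k - j = (M - j).+1 by lia.
    have -> : minn M k - j = M - j by lia.
    by rewrite binS bin1; move: 'C(_, _) 'C(_, _); lia.
  have -> : minn M.+1 k = k by lia.
  have -> : minn M k = k by lia.
  by lia.
apply: leq_trans (bound N) _; rewrite /pair_bound.
have -> : minn N j = j by lia.
by rewrite leq_add2l; apply: leq_bin2l; lia.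
Qed.

(** * Covers by s edges *)

Definition hits (x : nat) (e : nat * nat * nat) := x \in [:: e.1.1; e.1.2; e.2].

Definition edge_in (P : nat -> nat -> nat -> bool) (e : nat * nat * nat) := P e.1.1 e.1.2 e.2.

(** The s edges may repeat, so a smaller set of edges fails to cover as well. *)
Definition noncovering (s : nat) (P : nat -> nat -> nat -> bool) :=
  forall es, size es = s -> all (edge_in P) es ->
    ~~ all (fun x => has (hits x) es) (iota 0 (2 * s).+2).

(** The form in which noncovering is used: if some known edges es and m further
    triples would together cover, then one of these triples is not an edge. *)
Lemma missing_edge s P es m (f : nat -> nat * nat * nat) :
  noncovering s P -> size es + m = s -> all (edge_in P) es ->
  (forall x, x < (2 * s).+2 -> has (hits x) es \/ exists2 t, t < m & hits x (f t)) ->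
  exists2 t, t < m & ~~ edge_in P (f t).
Proof.
move=> Pnc es_s Pes cov; case fP: (all (edge_in P) (mkseq f m)).
  have := Pnc (es ++ mkseq f m).
  rewrite size_cat size_mkseq all_cat Pes fP => /(_ es_s isT) /negP[].
  apply/allP => x; rewrite mem_iota add0n has_cat => /cov[-> //|[t tm xt]].
  apply/orP; right; apply/hasP; exists (f t) => //.
  by apply/mapP; exists t; rewrite ?mem_iota.
move/negbT/allPn: fP => [e /mapP[t]]; rewrite mem_iota add0n => tm -> Pf.
by exists t.
Qed.

(** The edge {0, 1, 2s + 3} covers the two vertices that s edges avoiding 0 and
    covering {1, ..., 2s + 2} leave out. *)
Lemma tail_noncovering s P : noncovering s.+1 P -> P 0 1 (2 * s).+3 ->
  noncovering s (tail P).
Proof.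
move=> Pnc P01 es es_s Pes; apply/negP => /allP cov.
pose up (e : nat * nat * nat) := (e.1.1.+1, e.1.2.+1, e.2.+1).
apply: (negP (Pnc ((0, 1, (2 * s).+3) :: map up es) _ _)).
- by rewrite /= size_map es_s.
- by rewrite /= {1}/edge_in P01 all_map.
apply/allP => -[|x]; rewrite mem_iota add0n //= => xs; rewrite {1}/hits /= !inE /=.
have [->|xne] := eqVneq x (2 * s).+2; first by rewrite eqxx ?orbT.
rewrite has_map; suff: has (hits x) es.
  by move=> hx; apply/orP; right; apply: sub_has hx => e; rewrite /hits /= !inE !eqSS.
by apply: cov; rewrite mem_iota add0n; lia.
Qed.

(** The triples {1, t + 2, 2s + 3 - t} for t <= s cover everything but 0.  The
    one for t = 0 can be lowered to contain 0 instead of 1, and 1 is then still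
    covered by the others.  This limits the star at 1 among the edges avoiding 0. *)
Lemma tail_star_missing_pair s P : left_compressed P -> noncovering s.+1 P -> 0 < s ->
  exists2 t, t <= s & ~~ P 1 t.+2 ((2 * s).+3 - t).
Proof.
move=> Pd Pnc s0; case P12: (P 1 2 (2 * s).+3); last by exists 0; rewrite // subn0 P12.
have P02 : P 0 2 (2 * s).+3 by apply: Pd P12 => //; lia.
have [t ts Pt] : exists2 t, t < s & ~~ edge_in P (1, t.+3, (2 * s).+2 - t).
  apply: (missing_edge _ _ [:: (0, 2, (2 * s).+3)] _
    (fun t => (1, t.+3, (2 * s).+2 - t)) Pnc) => //.
    by rewrite /= /edge_in P02.
  move=> x xs; rewrite /= /hits !inE /=.
  have [|] := boolP [|| x == 0, x == 2 | x == (2 * s).+3]; first by left; rewrite orbF.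
  rewrite !negb_or => /and3P[x0 x2 x3]; right.
  have [xle|xle] := leqP x (s + 2).
    by exists (x - 3); rewrite ?inE; lia.
  by exists ((2 * s).+2 - x); rewrite ?inE; lia.
by exists t.+1 => //; rewrite (_ : (2 * s).+3 - t.+1 = (2 * s).+2 - t) //; lia.
Qed.

(** With {1, 2, 2s + 3}, a nested perfect matching of {3, ..., 2s + 2} joined to
    0 would complete a cover. *)
Lemma link_missing_pair_far s P : noncovering s.+1 P -> 0 < s -> P 1 2 (2 * s).+3 ->
  exists2 t, t < s & ~~ P 0 t.+3 ((2 * s).+2 - t).
Proof.
move=> Pnc s0 P12.
apply: (missing_edge _ _ [:: (1, 2, (2 * s).+3)] _ (fun t => (0, t.+3, (2 * s).+2 - t)) Pnc) => //.
  by rewrite /= /edge_in P12.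
move=> x xs; rewrite /= /hits !inE /=.
have [|] := boolP [|| x == 1, x == 2 | x == (2 * s).+3]; first by left; rewrite orbF.
rewrite !negb_or => /and3P[x0 x2 x3]; right.
have [xle|xle] := leqP x (s + 2).
  by exists (x - 3); rewrite ?inE; lia.
by exists ((2 * s).+2 - x); rewrite ?inE; lia.
Qed.

(** With {1, 2, 3}, a nested perfect matching of {4, ..., 2s + 3} joined to 0
    would complete a cover. *)
Lemma link_missing_pair_near s P : noncovering s.+1 P -> 0 < s -> P 1 2 3 ->
  exists2 t, t < s & ~~ P 0 t.+4 ((2 * s).+3 - t).
Proof.
move=> Pnc s0 P12.
apply: (missing_edge _ _ [:: (1, 2, 3)] _ (fun t => (0, t.+4, (2 * s).+3 - t)) Pnc) => //.
  by rewrite /= /edge_in P12.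
move=> x xs; rewrite /= /hits !inE /=.
have [|] := boolP [|| x == 1, x == 2 | x == 3]; first by left; rewrite orbF.
rewrite !negb_or => /and3P[x0 x2 x3]; right.
have [xle|xle] := leqP x (s + 3).
  by exists (x - 4); rewrite ?inE; lia.
by exists ((2 * s).+3 - x); rewrite ?inE; lia.
Qed.

(** * Numerical comparisons *)

Definition family2_size (n s : nat) := 'C(s.+1, 2) * (n - s.+1) + 'C(s.+1, 3).

Definition family3_size (s : nat) := 'C((2 * s).+1, 3).

Lemma bin2_double (m : nat) : 2 * 'C(m, 2) = m * m.-1.
Proof. by rewrite mulnC -[2 in LHS]/(2`!) bin_ffact !ffactnS ffactn0 muln1. Qed.

Lemma bin3_sextuple (m : nat) : 6 * 'C(m, 3) = m * m.-1 * m.-2.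
Proof. by rewrite mulnC -[6 in LHS]/(3`!) bin_ffact !ffactnS ffactn0 muln1 mulnA. Qed.

Lemma family3_size_rec s : family3_size s.+1 = family3_size s + (2 * s).+1 ^ 2.
Proof.
rewrite /family3_size mulnS !addSn add0n; set m := (2 * s).+1.
rewrite (binS m.+1 2) (binS m 2) -addnA; congr (_ + _).
have := bin2_double m; have := bin2_double m.+1; rewrite /= -mulnn.
move: 'C(m.+1, 2) 'C(m, 2) => A B; rewrite {}/m /=; lia.
Qed.

(** Removing the vertex 0 from the second family leaves the second family for
    s on N vertices; the link of 0 consists of the pairs that meet
    {0, ..., s}. *)
Lemma family2_size_rec N s : s.+1 <= N ->
  family2_size N.+1 s.+1 = family2_size N s + pair_bound N s.+1 1.
Proof.
rewrite /family2_size /pair_bound !subSS => h.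
rewrite (binS s.+1 2) (binS s.+1 1) bin1 (_ : 'C(1,2) = 0) //; nia.
Qed.

Lemma family2_size_le_family3_size s : 1 < s -> family2_size (2 * s).+2 s <= family3_size s.
Proof.
rewrite /family2_size /family3_size => h.
have := bin3_sextuple (2 * s).+1; have := bin3_sextuple s.+1; have := bin2_double s.+1.
have -> : (2 * s).+2 - s.+1 = s.+1 by lia.
case: s h => [|[|s]] //= _; nia.
Qed.

Lemma pair_bound_poly j Y v :
  2 * pair_bound (j + Y) j (2 * v).+1 + j = j * j + 2 * j * Y + (2 * v).+1 * (2 * v).
Proof.
rewrite /pair_bound addKn; have := bin2_double j; have := bin2_double (2 * v).+1.
by case: j => [|j] /=; move: 'C(_, _) 'C(_, _) => A B; lia.
Qed.

(** On t + 2 + X vertices and for s = t + 1, 6 (F_3 - F_2) is s times a quadratic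
    polynomial, so comparing the two sizes is a quadratic question; subtraction
    is avoided. *)
Lemma family23_size_poly t X :
  6 * family3_size t.+1 + t.+1 * (3 * t.+2 * X + t.+2 * t) =
  6 * family2_size (t.+2 + X) t.+1 + t.+1 * (2 * (2 * t).+3 * (2 * t).+1).
Proof.
rewrite /family2_size /family3_size (mulnS 2 t) (_ : t.+2 + X - t.+2 = X); last by lia.
have := bin3_sextuple (2 * t).+3; have := bin3_sextuple t.+2; have := bin2_double t.+2.
rewrite /= !addSn add0n; move: 'C(_, _) 'C(_, _) 'C(_, _) => A B C; nia.
Qed.

(** The induction step when {1, 2, 2s + 1} is an edge, for s = t + 1.  By
    convexity in j, either the link bound is at most its value at j = s, or N is
    small.  In the first case the only danger is a link larger than
    F_3(s) - F_3(s - 1), which makes N so large that F_2 exceeds F_3.  In the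
    second case N is so small that F_3 exceeds F_2 and the link bound is below
    F_3(s) - F_3(s - 1). *)
Lemma far_link_step N t j : 2 <= t -> 2 * t.+1 < N -> 2 <= j <= t.+1 ->
  pair_bound N j (2 * (t.+1 - j)).+1 + maxn (family2_size N t) (family3_size t) <=
    maxn (family2_size N.+1 t.+1) (family3_size t.+1).
Proof.
case: t => [//|t] ht hN /andP [hj hjt].
rewrite (family3_size_rec t.+1) family2_size_rec; last by lia.
have [v hv] : exists v, t.+2 = j + v by exists (t.+2 - j); lia.
have [X hX] : exists X, N = t.+2 + X by exists (N - t.+2); lia.
have [q hq] : exists q, q = (2 * t).+3 * (2 * t).+3 by exists ((2 * t).+3 * (2 * t).+3).
rewrite (_ : (2 * t.+1).+1 ^ 2 = q); last by rewrite hq mulnS.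
rewrite (_ : t.+2 - j = v); last by lia.
have hp := pair_bound_poly j (v + X) v; rewrite addnA -hv -hX in hp.
have hs := pair_bound_poly t.+2 X 0; rewrite -hX !muln0 in hs.
have hcmp := family23_size_poly t X; rewrite -hX in hcmp.
move: (family2_size N t.+1) (family3_size t.+1) (pair_bound _ _ _) (pair_bound _ _ _) hcmp hs hp
  => A B e es hcmp hs hp.
(* Convexity in j: comparing e with its end value es becomes linear in N and j. *)
have id : 2 * e + v * (2 * N + 3 * j) = 2 * es + v * (5 * t.+2 + 3) by subst N; nia.
have [ett|ett] := leqP (5 * t.+2 + 3) (2 * N + 3 * j).
  have e_es : e <= es by have := leq_mul (leqnn v) ett; lia.
  have [|big] := leqP e q; first by lia.
  suff : B <= A by lia.
  have : 7 * t.+2 <= 2 * X + 6.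
    rewrite leqNgt; apply/negP => h; have := leq_mul (leqnn t.+2) h; lia.
  move=> h.
  suff : t.+1 * (2 * (2 * t).+3 * (2 * t).+1) <= t.+1 * (3 * t.+2 * X + t.+2 * t) by lia.
  rewrite leq_mul2l /=; have := leq_mul (leqnn (3 * t.+2)) h; lia.
have e_q : e <= q.
  have Y2 : 2 * (v + X) <= 5 * v + 2 by lia.
  have := leq_mul (leqnn j) Y2.
  have [i hi] : exists i, j = i.+2 by exists j.-2; lia.
  rewrite hi in hv hp *.
  have -> : q = (2 * i + 2 * v + 3) * (2 * i + 2 * v + 3) by rewrite hq; congr (_ * _); lia.
  have := leq0n (i * i); have := leq0n (i * v); have := leq0n (v * v); lia.
suff : A <= B by lia.
have X2 : 2 * X <= 3 * t + 2 by lia.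
suff : t.+1 * (3 * t.+2 * X + t.+2 * t) <= t.+1 * (2 * (2 * t).+3 * (2 * t).+1) by lia.
rewrite leq_mul2l /=; have := leq_mul (leqnn (3 * t.+2)) X2; have := leq0n (t * t); lia.
Qed.

(** The induction step when {1, 2, 3} is an edge but the tail has at most
    F_3(s - 1) edges, for s = t + 1.  Now j may reach s + 1, where the link bound
    exceeds its value at j = s by N - s - 1.  The link bound is larger than
    F_3(s) - F_3(s - 1) only when N is large, and then F_2 exceeds F_3 by at
    least that excess. *)
Lemma near_link_step N t j : 2 <= t -> 2 * t.+1 < N -> 3 <= j <= t.+2 ->
  pair_bound N j (2 * (t.+2 - j)).+1 + family3_size t <=
    maxn (family2_size N.+1 t.+1) (family3_size t.+1).
Proof.
case: t => [//|t] ht hN /andP [hj hjt].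
rewrite (family3_size_rec t.+1) family2_size_rec; last by lia.
have [v hv] : exists v, t.+3 = j + v by exists (t.+3 - j); lia.
have [X hX] : exists X, N = t.+3 + X by exists (N - t.+3); lia.
have hX' : N = t.+2 + X.+1 by lia.
have [q hq] : exists q, q = (2 * t).+3 * (2 * t).+3 by exists ((2 * t).+3 * (2 * t).+3).
rewrite (_ : (2 * t.+1).+1 ^ 2 = q); last by rewrite hq mulnS.
rewrite (_ : t.+3 - j = v); last by lia.
have hp := pair_bound_poly j (v + X) v; rewrite addnA -hv -hX in hp.
have hs := pair_bound_poly t.+2 X.+1 0; rewrite -hX' !muln0 in hs.
have hcmp := family23_size_poly t X.+1; rewrite -hX' in hcmp.
move: (family2_size N t.+1) (family3_size t.+1) (pair_bound _ _ _) (pair_bound _ _ _) hcmp hs hp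
  => A B e es hcmp hs hp.
have [e_q|big] := leqP e q; first by lia.
suff h : B + X <= A /\ e <= es + X by lia.
have id : 2 * e + v * (2 * N + 3 * j) = 2 * (es + X) + v * (5 * t.+3 + 3) by subst N; lia.
have [ett|ett] := leqP (5 * t.+3 + 3) (2 * N + 3 * j).
  have e_es : e <= es + X by have := leq_mul (leqnn v) ett; lia.
  split=> //.
  have : 7 * t <= 2 * X + 1.
    rewrite leqNgt; apply/negP => h.
    have := leq_mul (leqnn t.+3) h; have := leq0n (t * X); lia.
  move=> h.
  suff : t.+1 * (2 * (2 * t).+3 * (2 * t).+1) + 6 * X <= t.+1 * (3 * t.+2 * X.+1 + t.+2 * t) by lia.
  case: t ht h {hN hj hjt hv hX hX' q hq hp hs hcmp big id ett} => [//|u] _ h.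
  have := leq_mul (leqnn (3 * u.+1 * u.+1 + 9 * u.+1)) h.
  have := leq0n (u * u * u); have := leq0n (u * u); lia.
have e_q : e <= q.
  have Y2 : 2 * (v + X) <= 5 * v + 2 by lia.
  have := leq_mul (leqnn j) Y2.
  have [i hi] : exists i, j = i.+3 by exists (j - 3); lia.
  rewrite hi in hv hp *.
  have -> : q = (2 * i + 2 * v + 3) * (2 * i + 2 * v + 3) by rewrite hq; congr (_ * _); lia.
  have := leq0n (i * i); have := leq0n (i * v); have := leq0n (v * v); lia.
lia.
Qed.

(** By convexity in j, the worst cases are j = t, which is one increment of F_2,
    and j = 0, which is the number of pairs, hence at most the number of
    triples, of a set of size 2t + 1. *)
Lemma star_tail_step t N j : 2 <= t -> 2 * t < N -> j <= t ->
  pair_bound N j (2 * (t - j)).+1 <= maxn (family2_size N.+1 t) (family3_size t).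
Proof.
case: t => [//|t] ht hN hj; rewrite family2_size_rec; last by lia.
have [v hv] : exists v, t.+1 = j + v by exists (t.+1 - j); lia.
have [X hX] : exists X, N = t.+1 + X by exists (N - t.+1); lia.
rewrite (_ : t.+1 - j = v); last by lia.
have hp := pair_bound_poly j (v + X) v; rewrite addnA -hv -hX in hp.
have hs := pair_bound_poly t.+1 X 0; rewrite -hX !muln0 in hs.
have := bin3_sextuple (2 * t.+1).+1; rewrite -/(family3_size t.+1).
move: (family2_size N t) (family3_size t.+1) (pair_bound _ _ _) (pair_bound _ _ _) hs hp
  => A B e es hs hp /= hB.
have id : 2 * e + v * (2 * N + 3 * j) = 2 * es + v * (5 * t.+1 + 3) by subst N; lia.
have [ett|ett] := leqP (5 * t.+1 + 3) (2 * N + 3 * j).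
  have e_es : e <= es by have := leq_mul (leqnn v) ett; lia.
  lia.
have Y2 : 2 * (v + X) <= 5 * v + 2 by lia.
have h1 : 2 * e <= (2 * t.+1).+1 * (2 * t.+1).
  rewrite hv; have := leq_mul (leqnn j) Y2; have := leq0n (j * j); have := leq0n (j * v); lia.
have h3 : 3 <= (2 * t.+1).-1 by lia.
have := leq_mul (leqnn ((2 * t.+1).+1 * (2 * t.+1))) h3; lia.
Qed.

(** * The bound for compressed families *)

(** For s = 2, noncovering says that an edge inside {0, ..., 5} excludes its
    complement, which leaves 10 edges on 6 vertices.  Each further vertex lies
    in at most 3 edges: they are {a, b, n} with {a, b} inside {0, 1, 2}, or with
    a = 0 and b < 4. *)
Lemma nontrivial_bound2 n P : 6 <= n -> left_compressed P -> noncovering 2 P -> P 1 2 3 ->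
  triple_count n P <= maxn (family2_size n 2) (family3_size 2).
Proof.
move=> n6 Pd Pnc P123; suff : triple_count n P <= 3 * (n - 3) + 1.
  move=> h; apply: leq_trans h _.
  by rewrite leq_max /family2_size; apply/orP; left; rewrite !binS.
have cross e1 e2 : all (fun x => has (hits x) [:: e1; e2]) (iota 0 6) ->
    edge_in P e1 + edge_in P e2 <= 1.
  move=> cov; have : ~~ (edge_in P e1 && edge_in P e2); last by do 2 case: (edge_in _ _).
  apply/negP => /andP[P1 P2].
  have /negP[] : ~~ all (fun x => has (hits x) [:: e1; e2]) (iota 0 6).
    by apply: Pnc; rewrite //= P1 P2.
  exact: cov.
rewrite -(subnKC n6); elim: (n - 6) => [|k IH].
  have := cross (0, 1, 2) (3, 4, 5) isT; have := cross (0, 1, 3) (2, 4, 5) isT.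
  have := cross (0, 1, 4) (2, 3, 5) isT; have := cross (0, 1, 5) (2, 3, 4) isT.
  have := cross (0, 2, 3) (1, 4, 5) isT; have := cross (0, 2, 4) (1, 3, 5) isT.
  have := cross (0, 2, 5) (1, 3, 4) isT; have := cross (0, 3, 4) (1, 2, 5) isT.
  have := cross (0, 3, 5) (1, 2, 4) isT; have := cross (0, 4, 5) (1, 2, 3) isT.
  rewrite /edge_in /= /triple_count unlock /=.
  do 20 move: (nat_of_bool (P _ _ _)) => ?; lia.
rewrite addnS triple_count_recr.
suff : pair_count (6 + k) (fun a b => P a b (6 + k)) <= 3 by lia.
case P12: (P 1 2 (6 + k)).
  rewrite (pair_count_support 3); [exact: pair_count_bin|by []|].
  move=> a b ab b3; apply/negP => Pab.
  have P034 : P 0 3 4 by apply: Pd Pab; lia.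
  have P125 : P 1 2 5 by apply: Pd P12; lia.
  by have := cross (0, 3, 4) (1, 2, 5) isT; rewrite /edge_in /= P034 P125.
rewrite (pair_count_support 4); [|by []|].
  apply: (@leq_trans (pair_count 4 (fun a _ => a == 0))); last by rewrite /pair_count unlock.
  apply: leq_pair_count => a b ab Pab; case: posnP => // a0.
  by case/negP: (negbT P12); apply: Pd Pab; lia.
move=> a b ab b3; apply/negP => Pab.
have P045 : P 0 4 5 by apply: Pd Pab; lia.
by have := cross (0, 4, 5) (1, 2, 3) isT; rewrite /edge_in /= P045 P123.
Qed.

(** The induction adds a bound for the edges avoiding 0 and one for the link of 0.
    If {1, 2, 2s + 1} is an edge, the pair missing from the link is a lower one; if
    it is not, the edges avoiding 0 are confined to {1, ..., 2s}.  Either gain suffices. *)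
Lemma nontrivial_bound s n P : 1 < s -> (2 * s).+1 < n -> left_compressed P ->
  noncovering s P -> P 1 2 3 -> triple_count n P <= maxn (family2_size n s) (family3_size s).
Proof.
elim: s n P => [//|s IH] n P hs hn Pd Pnc P123.
have [s1|s2] := leqP s 1.
  have s1E : s = 1 by lia.
  by rewrite s1E in hn Pnc *; apply: nontrivial_bound2.
have [P01|P01] := boolP (P 0 1 (2 * s).+3); last first.
  rewrite (triple_count_support (2 * s.+1).+1); [|by lia|]; last first.
    by move=> a b c abc sc; apply: contraNN P01; apply: Pd; lia.
  by rewrite leq_max triple_count_bin orbT.
case: n hn => [//|N] hN.
have Td := tail_left_compressed _ Pd; have Tnc := tail_noncovering _ _ Pnc P01.
(* A star at 1 is excluded from the induction, but is small by itself. *)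
have tail_le M : (2 * s).+1 < M ->
    triple_count M (tail P) <= maxn (family2_size M s) (family3_size s).
  case: M => [//|M] hM; have [T123|T123] := boolP (tail P 1 2 3); first exact: IH.
  have [t ts Pt] := tail_star_missing_pair _ _ Pd Pnc (ltnW s2).
  rewrite triple_count_star //.
  have Tl := link_left_compressed _ Td.
  apply: leq_trans (pair_count_missing_pair _ _ t ((2 * s).+1 - t) Tl _ _ _) _.
  - lia.
  - lia.
  - by apply: contraNN Pt; rewrite /tail -!subSn //; lia.
  rewrite (_ : (2 * s).+1 - t - t = (2 * (s - t)).+1); last by lia.
  by apply: star_tail_step => //; lia.
rewrite triple_count_recl.
have Ld := link_left_compressed _ Pd.
have [P12|P12] := boolP (P 1 2 (2 * s).+3).
  have [t ts Pt] := link_missing_pair_far _ _ Pnc (ltnW s2) P12.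
  apply: leq_trans (far_link_step N s t.+2 _ _ _) => //; [|by lia..].
  apply: leq_add; last by apply: tail_le; lia.
  rewrite (_ : (2 * (s.+1 - t.+2)).+1 = (2 * s).+1 - t - t.+2); last by lia.
  apply: pair_count_missing_pair => //; [lia|lia|].
  by apply: contraNN Pt; rewrite -subSn //; lia.
have [t ts Pt] := link_missing_pair_near _ _ Pnc (ltnW s2) P123.
apply: leq_trans (near_link_step N s t.+3 _ _ _) => //; [|by lia..].
apply: leq_add.
  rewrite (_ : (2 * (s.+2 - t.+3)).+1 = (2 * s).+2 - t - t.+3); last by lia.
  apply: pair_count_missing_pair => //; [lia|lia|].
  by apply: contraNN Pt; rewrite -subSn //; lia.
rewrite (triple_count_support (2 * s).+2); [|by lia|]; last first.
  by move=> a b c abc sc; apply: contraNN P12; apply: Pd; lia.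
apply: leq_trans (tail_le _ _) _ => //.
by rewrite geq_max family2_size_le_family3_size // leqnn.
Qed.

Lemma compressed_bound s n P : 1 < s -> (2 * s).+1 < n -> left_compressed P ->
  noncovering s P ->
  triple_count n P <= maxn 'C(n.-1, 2) (maxn (family2_size n s) (family3_size s)).
Proof.
move=> hs hn Pd Pnc; rewrite leq_max.
have [P123|P123] := boolP (P 1 2 3); first by rewrite nontrivial_bound ?orbT.
by case: n hn => [//|n] hn; rewrite triple_count_star // pair_count_bin.
Qed.

(** * Three-element sets as sorted triples *)

Definition tset (n a b c : nat) : {set 'I_n} := [set x : 'I_n | (x : nat) \in [:: a; b; c]].

Definition edges (n : nat) (F : {set {set 'I_n}}) (a b c : nat) : bool :=
  [&& a < b, b < c, c < n & tset n a b c \in F].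

Lemma edges_intro n (F : {set {set 'I_n}}) a b c : a < b < c -> c < n ->
  (tset n a b c \in F) -> edges n F a b c.
Proof. by rewrite /edges => /andP[-> ->] -> ->. Qed.

Lemma triples_tset n (A : {set 'I_n}) : A \in triples n ->
  exists t : 'I_n * 'I_n * 'I_n, t.1.1 < t.1.2 < t.2 /\ A = tset n t.1.1 t.1.2 t.2.
Proof.
rewrite inE cardE => /eqP A3.
have : sorted (fun x y : 'I_n => x < y) (enum A).
  rewrite /enum_mem; apply: sorted_filter; first by move=> x y z; apply: ltn_trans.
  by have := iota_ltn_sorted 0 n; rewrite -val_enum_ord sorted_map enumT.
have memA x : (x \in A) = (x \in enum A) by rewrite mem_enum.
case: (enum A) A3 memA => [|x [|y [|z []]]] //= _ memA; rewrite andbT => xyz.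
by exists (x, y, z); split=> //; apply/setP => w; rewrite memA !inE.
Qed.

Lemma tset_inj n (a b c a' b' c' : 'I_n) : a < b < c -> a' < b' < c' ->
  tset n a b c = tset n a' b' c' -> (a, b, c) = (a', b', c').
Proof.
move=> abc abc' /setP eqt.
have := eqt a; have := eqt b; have := eqt c; have := eqt a'; have := eqt b'; have := eqt c'.
rewrite !inE !eqxx !orbT /= => h1 h2 h3 h4 h5 h6.
have [ha hb hc] : [/\ (a : nat) = a', (b : nat) = b' & (c : nat) = c'].
  split; lia.
by rewrite (val_inj ha) (val_inj hb) (val_inj hc).
Qed.

Lemma card_edges n (F : {set {set 'I_n}}) : F \subset triples n ->
  #|F| = triple_count n (edges n F).
Proof.
move=> /subsetP F3.
pose S := [set t : 'I_n * ('I_n * 'I_n) | edges n F t.2.2 t.2.1 t.1].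
pose g (t : 'I_n * ('I_n * 'I_n)) := tset n t.2.2 t.2.1 t.1.
have FS : F = g @: S.
  apply/setP => A; apply/idP/imsetP => [AF|[[c [b a]]]]; last first.
    by rewrite inE /= => /and4P[_ _ _ tF] ->.
  have [[[a b] c] /= [abc AE]] := triples_tset _ _ (F3 _ AF).
  exists (c, (b, a)); rewrite ?inE /edges //= ltn_ord -AE AF.
  by case/andP: abc => -> ->.
rewrite {1}FS card_in_imset; last first.
  move=> [c [b a]] [c' [b' a']]; rewrite !inE /g /=.
  move=> /and4P[ab bc _ _] /and4P[ab' bc' _ _] eqt.
  have abc : a < b < c by rewrite ab.
  have abc' : a' < b' < c' by rewrite ab'.
  by have [-> -> ->] := tset_inj _ a b c a' b' c' abc abc' eqt.
have widen c (G : nat -> nat) : c <= n -> (forall b, c <= b -> G b = 0) ->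
    \sum_(0 <= b < c) G b = \sum_(b < n) G b.
  move=> cn G0; rewrite -(big_mkord xpredT) [RHS](big_cat_nat (n := c)) //=.
  rewrite [X in _ + X]big_nat_cond [X in _ + X]big1 ?addn0 // => b /andP[/andP[cb _] _].
  exact: G0.
rewrite /triple_count big_mkord.
transitivity (\sum_(c < n) \sum_(b < n) \sum_(a < n) (edges n F a b c : nat)).
  rewrite -sum1dep_card big_mkcond /=.
  rewrite -(pair_bigA _ (fun (c : 'I_n) (p : 'I_n * 'I_n) =>
    if edges n F p.2 p.1 c then 1 else 0)) /=.
  apply: eq_bigr => c _.
  rewrite -(pair_bigA _ (fun b a : 'I_n => if edges n F a b c then 1 else 0)) /=.
  by apply: eq_bigr => b _; apply: eq_bigr => a _; case: edges.
apply: eq_bigr => c _; symmetry.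
transitivity (\sum_(0 <= b < c) \sum_(a < n) (edges n F a b c : nat)).
  apply: eq_big_nat => b /andP[_ bc]; apply: (widen b (fun a => edges n F a b c : nat)).
    exact/ltnW/(ltn_trans bc).
  by move=> a ba; rewrite /edges ltnNge ba.
apply: (widen c (fun b => \sum_(a < n) (edges n F a b c : nat))); first exact: ltnW.
by move=> b cb; apply: big1 => a _; rewrite /edges [b < c]ltnNge cb andbF.
Qed.

Lemma tset_triples n a b c : a < b < c -> c < n -> tset n a b c \in triples n.
Proof.
move=> /andP[ab bc] cn; have bn := ltn_trans bc cn; have an := ltn_trans ab bn.
rewrite inE (_ : tset n a b c = [set Ordinal an; Ordinal bn; Ordinal cn]).
  by rewrite setUC cardsU1 cards2 !inE -!val_eqE /=
    (ltn_eqF ab) (gtn_eqF bc) (gtn_eqF (ltn_trans ab bc)).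
by apply/setP => x; rewrite !inE -!val_eqE orbA.
Qed.

(** * Bounded unions *)

(** Unlike [is_U], this bounds unions of fewer than s edges too; shifting can
    identify edges chosen for a cover, so only this form is visibly preserved. *)
Definition cover_bounded n (s q : nat) (F : {set {set 'I_n}}) :=
  forall E : {set {set 'I_n}}, E \subset F -> #|E| <= s -> #|cover E| <= q.

(** Any set of at most s edges extends to s distinct edges. *)
Lemma is_U_cover_bounded n s q (F : {set {set 'I_n}}) :
  s <= #|F| -> is_U s q F -> cover_bounded n s q F.
Proof.
move=> sF FU E EF Es.
pose l := enum E ++ take (s - #|E|) (enum (F :\: E)).
have ls : size l = s.
  rewrite size_cat size_takel -?cardE; first lia.
  by rewrite cardsD (setIidPr EF) leq_sub2r.
have lu : uniq l.
  rewrite cat_uniq enum_uniq take_uniq ?enum_uniq // andbT; apply/hasPn => A /mem_take.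
  by rewrite !mem_enum inE => /andP[].
have lF A : A \in l -> A \in F.
  rewrite mem_cat mem_enum => /orP[/(subsetP EF)//|/mem_take].
  by rewrite mem_enum inE => /andP[].
apply: leq_trans (FU (fun i => nth set0 l i) _ _).
- apply/subset_leq_card/bigcupsP => A AE; have Al : A \in l by rewrite mem_cat mem_enum AE.
  have il : index A l < s by rewrite -ls index_mem.
  by apply: (bigcup_max (Ordinal il)) => //=; rewrite nth_index.
- by move=> i j /eqP; rewrite nth_uniq ?ls // => /eqP/val_inj.
- by move=> i; apply/lF/mem_nth; rewrite ls.
Qed.

Lemma card_initial n k : k <= n -> #|initial n k| = k.
Proof.
move=> kn; rewrite /initial -sum1dep_card -(big_ord_widen n (fun _ => 1) kn).
by rewrite sum1_card card_ord.
Qed.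

Lemma edges_noncovering n s (F : {set {set 'I_n}}) : (2 * s).+2 <= n ->
  cover_bounded n s (2 * s + 1) F -> noncovering s (edges n F).
Proof.
move=> hn Fc es es_s esF; apply/negP => /allP cov.
pose E' : {set {set 'I_n}} := [set:: [seq tset n e.1.1 e.1.2 e.2 | e <- es]].
have E'F : E' \subset F.
  by apply/subsetP => A; rewrite inE => /mapP[e /(allP esF)/and4P[_ _ _ eF] ->].
have E's : #|E'| <= s.
  by rewrite cardsE -es_s -(size_map (fun e => tset n e.1.1 e.1.2 e.2)) card_size.
have := Fc _ E'F E's; rewrite leqNgt => /negP[].
rewrite addn1 -(card_initial n (2 * s).+2) //; apply: subset_leq_card.
apply/subsetP => x; rewrite inE => xs.
have /hasP[e ee xe] : has (hits x) es by apply: cov; rewrite mem_iota.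
apply/bigcupP; exists (tset n e.1.1 e.1.2 e.2); last by rewrite inE.
by rewrite inE; apply/mapP; exists e.
Qed.

(** * Shifting *)

Definition swap n (i j : 'I_n) (A : {set 'I_n}) : {set 'I_n} := tperm i j @: A.

Lemma mem_swap n (i j x : 'I_n) (A : {set 'I_n}) : (x \in swap n i j A) = (tperm i j x \in A).
Proof. by rewrite /swap -{1}(tpermK i j x) (mem_imset _ _ perm_inj). Qed.

Lemma swapK n (i j : 'I_n) : involutive (swap n i j).
Proof. by move=> A; apply/setP => x; rewrite !mem_swap tpermK. Qed.

Definition movable n (i j : 'I_n) (F : {set {set 'I_n}}) (A : {set 'I_n}) :=
  [&& j \in A, i \notin A & swap n i j A \notin F].

Definition push n (i j : 'I_n) (F : {set {set 'I_n}}) (A : {set 'I_n}) :=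
  if movable n i j F A then swap n i j A else A.

Definition shift n (i j : 'I_n) (F : {set {set 'I_n}}) := push n i j F @: F.

Lemma push_inj n (i j : 'I_n) (F : {set {set 'I_n}}) : {in F &, injective (push n i j F)}.
Proof.
move=> A B AF BF; rewrite /push /movable.
case: ifP => [/and3P[_ _ AF']|_]; case: ifP => [/and3P[_ _ BF']|_] //.
- exact: (can_inj (swapK n i j)).
- by move=> AB; rewrite AB BF in AF'.
- by move=> AB; rewrite -AB AF in BF'.
Qed.

Lemma card_shift n (i j : 'I_n) (F : {set {set 'I_n}}) : #|shift n i j F| = #|F|.
Proof. exact/card_in_imset/push_inj. Qed.

Lemma shift_triples n (i j : 'I_n) (F : {set {set 'I_n}}) :
  F \subset triples n -> shift n i j F \subset triples n.
Proof.
move=> /subsetP F3; apply/subsetP => _ /imsetP[A /F3 A3 ->].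
by move: A3; rewrite !inE /push; case: ifP => // _; rewrite card_imset //; apply: perm_inj.
Qed.

(** Given edges E of the shifted family, not all of them in F, each can be
    replaced by an edge of F so that the union does not shrink.  The edges
    outside F are swapped back, which makes j covered.  If j was covered by E,
    then i stays covered, because edges of E that contain j but not i have their
    swap in F and are swapped as well.  If it was not, j makes up for the
    possible loss of i. *)
Lemma shift_cover_bounded n (i j : 'I_n) s q (F : {set {set 'I_n}}) :
  cover_bounded n s q F -> cover_bounded n s q (shift n i j F).
Proof.
move=> Fc E /subsetP EF Es.
pose h A := if (A \in F) && ((j \notin A) || (i \in A)) then A else swap n i j A.
have newP A : A \in E -> A \notin F -> [/\ i \in A, j \notin A & swap n i j A \in F].
  move=> /EF/imsetP[B BF ->]; rewrite /push; case: ifP => [/and3P[jB iB _] _|_]; last by rewrite BF.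
  by rewrite !mem_swap tpermL tpermR swapK.
have oldP A : A \in E -> A \in F -> j \in A -> i \notin A -> swap n i j A \in F.
  move=> /EF/imsetP[B BF ->]; rewrite /push; case: ifP => [/and3P[_ _ /negP BF']|]; first by [].
  by rewrite /movable => /and3P mv _ jB iB; apply/negPn/negP => sB; apply: mv.
have hEF : h @: E \subset F.
  apply/subsetP => _ /imsetP[A AE ->]; rewrite /h.
  case: ifP => [/andP[]//|]; have [AF|AF] := boolP (A \in F); last by case: (newP A).
  by move=> /negbT; rewrite /= negb_or negbK => /andP[jA iA]; apply: oldP.
have hEs : #|h @: E| <= s by apply: leq_trans (leq_imset_card _ _) Es.
have cov_h x : x != i -> x != j -> x \in cover E -> x \in cover (h @: E).
  move=> xi xj /bigcupP[A AE xA]; apply/bigcupP; exists (h A); first exact: imset_f.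
  by rewrite /h; case: ifP => // _; rewrite mem_swap tpermD // eq_sym.
have [EF'|/subsetPn[A0 A0E A0F]] := boolP (E \subset F); first exact: Fc.
apply: leq_trans (Fc _ hEF hEs).
have [iA0 jA0 _] := newP _ A0E A0F.
have i_cov : i \in cover E by apply/bigcupP; exists A0.
have j_cov : j \in cover (h @: E).
  apply/bigcupP; exists (h A0); first exact: imset_f.
  by rewrite /h (negbTE A0F) /= mem_swap tpermR.
have [jE|jE] := boolP (j \in cover E).
  have i_cov' : i \in cover (h @: E).
    case/bigcupP: jE => A AE jA; apply/bigcupP; exists (h A); first exact: imset_f.
    rewrite /h jA /=; case: ifP => [/andP[] //|_].
    by rewrite mem_swap tpermL.
  apply/subset_leq_card/subsetP => x xE.
  have [->//|xi] := eqVneq x i; have [->//|xj] := eqVneq x j.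
  exact: cov_h.
rewrite -(card_imset _ (@perm_inj _ (tperm i j))).
apply/subset_leq_card/subsetP => _ /imsetP[x xE ->].
have [->|xi] := eqVneq x i; first by rewrite tpermL.
have [xj|xj] := eqVneq x j; first by rewrite xj (negbTE jE) in xE.
by rewrite tpermD 1?eq_sym //; apply: cov_h.
Qed.

Definition weight n (F : {set {set 'I_n}}) := \sum_(A in F) \sum_(x in A) (x : nat).

Lemma weight_shift n (i j : 'I_n) (F : {set {set 'I_n}}) (A : {set 'I_n}) :
  i < j -> A \in F -> movable n i j F A ->
  weight n (shift n i j F) < weight n F.
Proof.
move=> ij AF Amv; rewrite /weight /shift big_imset /=; last exact: push_inj.
have lighter (B : {set 'I_n}) : j \in B -> i \notin B ->
    \sum_(x in swap n i j B) (x : nat) < \sum_(x in B) (x : nat).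
  move=> jB iB; rewrite /swap big_imset /=; last by move=> x y _ _; apply: perm_inj.
  rewrite (bigD1 j) //= [X in _ < X](bigD1 j) //= tpermR -addSn.
  rewrite leq_add // leq_sum // => x /andP[xB xj].
  by rewrite tpermD // 1?eq_sym //; apply: contraNneq iB => <-.
rewrite (bigD1 A) //= [X in _ < X](bigD1 A) //= -addSn leq_add //.
  by rewrite /push Amv; case/and3P: Amv => jA iA _; apply: lighter.
apply: leq_sum => B _; rewrite /push; case: ifP => // /and3P[jB iB _].
exact/ltnW/lighter.
Qed.

Lemma exists_shift_stable n s q (F : {set {set 'I_n}}) :
  F \subset triples n -> cover_bounded n s q F ->
  exists G : {set {set 'I_n}}, [/\ G \subset triples n, #|G| = #|F|, cover_bounded n s q G &
    forall (i j : 'I_n) (A : {set 'I_n}), i < j -> A \in G -> ~~ movable n i j G A].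
Proof.
have [m] := ubnP (weight n F); elim: m F => // m IH F wF F3 Fc.
have [/existsP[i /existsP[j /existsP[A /and3P[ij AF mv]]]]|stable] :=
  boolP [exists i : 'I_n, exists j : 'I_n, exists A : {set 'I_n},
    [&& i < j, A \in F & movable n i j F A]].
  have wS := weight_shift _ _ _ _ _ ij AF mv.
  have [|||G [G3 GF Gc Gs]] := IH (shift n i j F).
  - by apply: leq_trans wS _; rewrite -ltnS.
  - exact: shift_triples.
  - exact: shift_cover_bounded.
  by exists G; split=> //; rewrite GF card_shift.
exists F; split=> // i j A ij AF; apply: contraNN stable => mv.
by apply/existsP; exists i; apply/existsP; exists j; apply/existsP; exists A; apply/and3P.
Qed.

(** The entries are lowered one at a time, the smallest first, so that the
    triple stays sorted throughout and each step is one shift. *)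
Lemma edges_left_compressed n (F : {set {set 'I_n}}) :
  (forall (i j : 'I_n) (A : {set 'I_n}), i < j -> A \in F -> ~~ movable n i j F A) ->
  left_compressed (edges n F).
Proof.
move=> stable.
have dec (i j : nat) a b c a' b' c' : i < j -> j < n ->
   j \in [:: a; b; c] -> i \notin [:: a; b; c] ->
   (forall x, (x \in [:: a'; b'; c']) =
      if x == i then true else if x == j then false else x \in [:: a; b; c]) ->
   tset n a b c \in F -> tset n a' b' c' \in F.
  move=> ij jn jA iA eqs tF.
  have i_n := ltn_trans ij jn.
  have := stable (Ordinal i_n) (Ordinal jn) (tset n a b c) ij tF.
  rewrite /movable [_ \in tset _ _ _ _]in_set [X in ~~ X && _]in_set jA iA /= negbK.
  suff -> : swap n (Ordinal i_n) (Ordinal jn) (tset n a b c) = tset n a' b' c' by [].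
  apply/setP => x; rewrite mem_swap [RHS]in_set in_set eqs.
  case: tpermP => [->|->|/eqP xi /eqP xj] /=.
  - by rewrite eqxx.
  - by rewrite eqxx gtn_eqF // (negbTE iA).
  - by move: xi xj; rewrite -!val_eqE /= => /negbTE-> /negbTE->.
move=> a b c a' b' c' /andP[ab' bc'] ha hb hc /and4P[ab bc cn tF].
have tF1 : tset n a' b c \in F.
  have [->//|ne] := eqVneq a' a; apply: (dec a' a) tF; rewrite ?inE; try lia.
  move=> x; rewrite !inE; do ![case: eqP => //=]; lia.
have tF2 : tset n a' b' c \in F.
  have [->//|ne] := eqVneq b' b; apply: (dec b' b) tF1; rewrite ?inE; try lia.
  move=> x; rewrite !inE; do ![case: eqP => //=]; lia.
have tF3 : tset n a' b' c' \in F.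
  have [->//|ne] := eqVneq c' c; apply: (dec c' c) tF2; rewrite ?inE; try lia.
  move=> x; rewrite !inE; do ![case: eqP => //=]; lia.
by rewrite /edges ab' bc' tF3 (leq_ltn_trans hc cn).
Qed.

(** * The three extremal families and the theorem *)

Lemma card_family1 n : 0 < n -> 'C(n.-1, 2) <= #|family1 n|.
Proof.
case: n => [//|n] _; rewrite card_edges; last by apply/subsetP => A; rewrite inE => /andP[].
rewrite triple_count_recl; apply: leq_trans (leq_addr _ _).
rewrite -pair_count_true; apply: leq_pair_count => b c /andP[bc cn] _.
apply: edges_intro => //; rewrite inE tset_triples //=.
by apply/card_gt0P; exists ord0; rewrite !inE.
Qed.

Lemma card_family2 n s : s < n -> family2_size n s <= #|family2 n s|.
Proof.
move=> sn; rewrite card_edges; last by apply/subsetP => A; rewrite inE => /andP[].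
apply: (@leq_trans (triple_count n (fun a b c => b < s.+1))); last first.
  apply: leq_triple_count => a b c abc cn bs; apply: edges_intro => //.
  case/andP: (abc) => ab bc; have bn := ltn_trans bc cn; have an := ltn_trans ab bn.
  rewrite inE tset_triples //=.
  have <- : #|[set Ordinal an; Ordinal bn]| = 2 by rewrite cards2 -val_eqE /= ltn_eqF.
  apply/subset_leq_card/subsetP => x; rewrite !inE => /orP[]/eqP-> /=; rewrite eqxx ?orbT //=.
  exact: ltn_trans bs.
rewrite /family2_size -{2}(subnKC sn); elim: (n - s.+1) => [|k IH].
  rewrite muln0 addn0 add0n -triple_count_true; apply: leq_triple_count => a b c /andP[_ bc] cs _.
  exact: ltn_trans cs.
rewrite addnS triple_count_recr mulnS -addnA addnC leq_add //.
rewrite (pair_count_support s.+1) ?leq_addr //; last by move=> b c bc sc; rewrite -leqNgt.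
by rewrite -pair_count_true; apply: leq_pair_count => b c /andP[].
Qed.

Lemma card_family3 n s : 2 * s < n -> family3_size s <= #|family3 n s|.
Proof.
move=> sn; rewrite card_edges; last by apply/subsetP => A; rewrite inE => /andP[].
have -> : family3_size s = triple_count n (fun _ _ c => c < (2 * s).+1).
  rewrite (triple_count_support (2 * s).+1) //; last by move=> a b c _; rewrite -leqNgt.
  rewrite /family3_size -triple_count_true; apply/eqP; rewrite eqn_leq.
  by apply/andP; split; apply: leq_triple_count.
apply: leq_triple_count => a b c abc cn cs; apply: edges_intro => //.
rewrite inE tset_triples //=; have := tset_triples n a b c abc cn.
rewrite inE => /eqP <-; apply/subset_leq_card/subsetP => x xt.
rewrite in_setI xt inE; move: xt; rewrite !inE => xt.
by apply: leq_ltn_trans cs; case/andP: abc => ab bc; case/or3P: xt => /eqP->; lia.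
Qed.

Theorem theorem1p2 (n s : nat) (hs : 2 <= s) (hn : 2 * s + 2 <= n)
    (F : {set {set 'I_n}}) (hF : is_3graph F) (hU : is_U s (2 * s + 1) F) :
  #|F| <= maxn #|family1 n| (maxn #|family2 n s| #|family3 n s|).
Proof.
rewrite addn2 in hn.
(* A family of fewer than s edges is smaller than the third family. *)
have [sF|Fs] := leqP s #|F|; last first.
  have s_le : s <= family3_size s
    by case: s hs {hn hU Fs} => [|s] // _; rewrite family3_size_rec -mulnn; lia.
  rewrite !leq_max; apply/orP; right; apply/orP; right.
  by apply: leq_trans (leq_trans (ltnW Fs) s_le) (card_family3 _ _ _); lia.
have Fc := is_U_cover_bounded _ _ _ _ sF hU.
have [G [G3 GF Gc Gs]] := exists_shift_stable _ _ _ _ hF Fc.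
rewrite -GF card_edges //.
apply: leq_trans (compressed_bound s n _ hs hn (edges_left_compressed _ _ Gs)
  (edges_noncovering _ _ _ hn Gc)) _.
rewrite !geq_max !leq_max.
by rewrite card_family1 ?card_family2 ?card_family3 ?orbT //; lia.
Qed.
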